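(* Let $n\ge 2$. Let $\pi,\sigma\in\mathfrak{B}_n$ have respective length vectors $(\ell_1,\ell_2,\ell_3,\ell_4)$ and $(m_1,m_2,m_3,m_4)$, and suppose $\pi\le\sigma$. Let $r=\ell_1-m_1+\ell_4-m_4$. Then there are exactly $\binom{r}{\ell_1-m_1}\binom{r}{m_2-\ell_2}$ saturated chains $\pi=\pi_1\vartriangleleft\pi_2\vartriangleleft\cdots\vartriangleleft\pi_{r+1}=\sigma$ (with $r$ covering steps) between $\pi$ and $\sigma$ in $(\mathfrak{B}_n,\le)$. Moreover, there are exactly $4^{n-2}$ maximal chains in $(\mathfrak{B}_n,\le)$.
   Context: $\mathfrak{S}_n$ is the set of permutations of $[n]=\{1,\dots,n\}$, in one-line notation. A reduction of $\omega\in\mathfrak{S}_n$ interchanges $\omega(i)$ and $\omega(j)$ for some $i<j$ with $\omega(i)>\omega(j)$. Bruhat order: $\pi\le\sigma$ if $\pi$ is obtained from $\sigma$ by a (possibly empty) sequence of reductions. $\mathfrak{B}_n\subseteq\mathfrak{S}_n$ is the set of bigrassmannian permutations (both $\omega$ and $\omega^{-1}$ have exactly one descent), with the order inherited from Bruhat order; equivalently $\omega=1\cdots a\,(b+1)\cdots c\,(a+1)\cdots b\,(c+1)\cdots n$ for a unique triple $0\le a<b<c\le n$. The length vector of such an element is $(\ell_1,\ell_2,\ell_3,\ell_4)=(a+1,b-a,c-b,n+1-c)$. $\pi\vartriangleleft\sigma$ means $\sigma$ covers $\pi$ in $\mathfrak{B}_n$: $\pi<\sigma$ and no $\rho\in\mathfrak{B}_n$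 has $\pi<\rho<\sigma$. A maximal chain is a saturated chain (consecutive elements related by $\vartriangleleft$) connecting a minimal element and a maximal element of $(\mathfrak{B}_n,\le)$. *)

(* Defs.v *)
From mathcomp Require Import all_boot all_fingroup.

Set Implicit Arguments.
Unset Strict Implicit.
Unset Printing Implicit Defensive.

(* [P] holds for exactly [N] elements of [T], where [T] may be infinite. *)
Definition exactly (T : eqType) (P : pred T) (N : nat) : Prop :=
  exists s : seq T, [/\ uniq s, s =i P & size s = N].

(* Permutations of {1, ..., n} are elements of 'S_n acting on the 0-based
   'I_n; [one_line] restores the 1-based values. *)
Definition one_line n (w : 'S_n) : seq nat :=
  [seq (w i).+1 | i <- enum 'I_n].

Definition descents n (w : 'S_n) : {set 'I_n} :=
  [set i : 'I_n | [exists j : 'I_n, (j == i.+1 :> nat) && (w j < w i)]].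

Definition bigrassmannian n : pred 'S_n := fun w =>
  (#|descents w| == 1) && (#|descents w^-1%g| == 1).

(* [(tperm i j * s)%g] is the permutation x |-> s (tperm i j x): it exchanges
   the entries of s in positions i and j. *)
Definition reduction n : rel 'S_n := fun s p =>
  [exists i : 'I_n, [exists j : 'I_n,
    [&& i < j, s j < s i & p == (tperm i j * s)%g]]].

Definition bruhat_le n : rel 'S_n := fun p s => connect (@reduction n) s p.

Definition bruhat_lt n : rel 'S_n := fun p s => (p != s) && bruhat_le p s.

Definition length_vector n (w : 'S_n) (l1 l2 l3 l4 : nat) : Prop :=
  exists a b c : nat,
    [/\ a < b < c, c <= n,
        one_line w = iota 1 a ++ iota b.+1 (c - b)
                       ++ iota a.+1 (b - a) ++ iota c.+1 (n - c)
      & [/\ l1 = a + 1, l2 = b - a, l3 = c - b & l4 = n + 1 - c]].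

Definition covered_by n : rel 'S_n := fun p s =>
  [&& bigrassmannian p, bigrassmannian s, bruhat_lt p s &
    ~~ [exists q : 'S_n,
          [&& bigrassmannian q, bruhat_lt p q & bruhat_lt q s]]].

Definition minimal_elt n : pred 'S_n := fun p =>
  bigrassmannian p && ~~ [exists q : 'S_n, bigrassmannian q && bruhat_lt q p].

Definition maximal_elt n : pred 'S_n := fun p =>
  bigrassmannian p && ~~ [exists q : 'S_n, bigrassmannian q && bruhat_lt p q].

(* A chain with r covering steps is listed by its r + 1 elements. *)
Definition saturated_chain n (p s : 'S_n) : pred (seq 'S_n) := fun c =>
  if c is x :: c' then
    [&& bigrassmannian x, x == p, path (@covered_by n) x c' & last x c' == s]
  else false.

Definition maximal_chain n : pred (seq 'S_n) := fun c =>
  [exists p : 'S_n, [exists s : 'S_n,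
    [&& minimal_elt p, maximal_elt s & saturated_chain p s c]]].

(* Main.v *)
Require Import Defs.
From mathcomp Require Import all_boot all_fingroup.
From mathcomp Require Import zify.

Set Implicit Arguments.
Unset Strict Implicit.
Unset Printing Implicit Defensive.

(* In terms of length vectors, pi <= sigma holds in B_n iff l1 >= m1, l4 >= m4,
   l2 <= m2 and l3 <= m3. For necessity, count the entries that are at least b
   among the first a + l3 positions: a reduction never increases this number,
   and for pi it equals l3. For sufficiency, each unit move in this order is an
   explicit sequence of reductions. Hence l2 + l3 is a rank function, and going
   up one step lowers one of l1, l4 and raises one of l2, l3. These two choices
   are independent, so the chains are counted by a product of two binomial
   coefficients, by Pascal's rule. The minimal elements have l2 = l3 = 1, the
   maximal ones have l1 = l4 = 1, and all such pairs are comparable, so the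
   maximal chains number (sum_i C(n-2,i)) (sum_j C(n-2,j)) = 4^(n-2). *)

(** * Exact counts of lists *)

Lemma exactly_ext (T : eqType) (P Q : pred T) N :
  P =1 Q -> exactly P N -> exactly Q N.
Proof.
move=> PQ [s [us sP sN]]; exists s; split=> // x.
by rewrite sP; exact: PQ.
Qed.

Lemma exactly0 (T : eqType) (P : pred T) : P =1 pred0 -> exactly P 0.
Proof. by move=> P0; exists [::]; split=> // x; rewrite in_nil; symmetry; exact: P0. Qed.

Lemma exactly_cons (T : eqType) (p : T) (P : pred (seq T)) N :
  exactly P N ->
  exactly (fun c => if c is x :: c' then (x == p) && P c' else false) N.
Proof.
move=> [s [us sP sN]]; exists (map (cons p) s); split.
- by rewrite map_inj_uniq // => x y [].
- case=> [|x c]; first by apply/mapP=> -[].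
  apply/mapP/idP=> [[c' cs [-> ->]]|/andP[/eqP-> Pc]].
    by rewrite unfold_in /= eqxx /=; rewrite sP in cs.
  by exists c; rewrite ?sP.
- by rewrite size_map.
Qed.

Lemma exactly_exists (I : finType) (T : eqType) (P : I -> pred T) N :
  (forall i, exactly (P i) (N i)) ->
  (forall i j x, P i x -> P j x -> i = j) ->
  exactly (fun x => [exists i, P i x]) (\sum_i N i).
Proof.
move=> /fin_all_exists[s sP] disj.
exists [seq x | i <- enum I, x <- s i]; split.
- apply: allpairs_uniq_dep; first exact: enum_uniq.
    by move=> i _; case: (sP i).
  move=> [i x] [j y] /allpairsPdep[i' [x' [_ x's [-> ->]]]].
  move=> /allpairsPdep[j' [y' [_ y's [-> ->]]]] /= exy.
  case: (sP i') (sP j') => _ si _ [_ sj _].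
  by move: y's x's; rewrite -exy si sj => /disj h /h ->.
- move=> x; apply/allpairsPdep/existsP=> [[i [y [_ ys ->]]]|[i Pi]].
    by exists i; case: (sP i) ys => _ -> _.
  by exists i, x; split; rewrite ?mem_enum //; case: (sP i) => _ -> _.
- rewrite size_allpairs_dep sumnE big_map big_enum /=.
  by apply: eq_bigr => i _; case: (sP i).
Qed.

(** * A rank statistic that is monotone in Bruhat order *)

Lemma card_ord_interval n x y :
  y <= n -> #|[set k : 'I_n | x <= k < y]| = y - x.
Proof.
move=> yn; rewrite -sum1_card.
under eq_bigl do rewrite inE.
rewrite -(big_mkord (fun k => x <= k < y) (fun=> 1)).
have [xy|yx] := leqP x y; last first.
  by rewrite big1 //; lia.
rewrite (@big_cat_nat _ _ _ x) /=; [|lia..].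
rewrite (@big_cat_nat _ _ _ y _ n) /=; [|lia..].
rewrite big_nat_cond big_pred0 ?add0n; last by move=> k; lia.
rewrite addnC big_nat_cond big_pred0 ?add0n; last by move=> k; lia.
rewrite big_nat_cond (eq_bigl (fun k => (x <= k < y) && true)); last by move=> k; lia.
by rewrite -big_nat_cond sum_nat_const_nat muln1.
Qed.

Lemma card_perm_interval n (w : 'S_n) x y :
  y <= n -> #|[set k : 'I_n | x <= w k < y]| = y - x.
Proof.
move=> yn; rewrite -(card_ord_interval x yn).
rewrite -[RHS](card_preimset _ (@perm_inj _ w)).
by apply: eq_card => k; rewrite !inE.
Qed.

(** This is an entry of the rank matrix used in the tableau criterion for Bruhat order. *)
Definition excess n (w : 'S_n) i j := #|[set k : 'I_n | (k < i) && (j <= w k)]|.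

(** The first [i] positions hold [i - excess w i j] of the [j] values below [j], so the others of
    these values sit at positions from [i] on. *)
Lemma excess_compl n (w : 'S_n) i j : i <= n -> j <= n ->
  excess w i j + j = i + #|[set k : 'I_n | (i <= k) && (w k < j)]|.
Proof.
move=> i_n j_n.
have := card_perm_interval w 0 j_n; have := card_ord_interval 0 i_n.
rewrite -(cardsID [set k : 'I_n | j <= w k]).
rewrite -[#|[set k : 'I_n | _ <= w k < _]|](cardsID [set k : 'I_n | i <= k]).
set A := #|_ :&: _|; set B := #|_ :\: _|; set C := #|_ :&: _|; set D := #|_ :\: _|.
have -> : excess w i j = A by apply: eq_card => k; rewrite !inE.
have -> : #|[set k : 'I_n | (i <= k) && (w k < j)]| = C.
  by apply: eq_card => k; rewrite !inE andbC.
have -> : B = D by apply: eq_card => k; rewrite !inE; lia.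
lia.
Qed.

(** If the cut at [i] separates the swapped positions, the prefix trades an entry for a smaller one.
    Otherwise the transposition preserves the prefix, and the two counts agree. *)
Lemma reduction_excess n (s p : 'S_n) i j :
  reduction s p -> excess p i j <= excess s i j.
Proof.
move=> /existsP[x /existsP[y /and3P[xy syx /eqP->]]].
have [/andP[xi iy]|both] := boolP (x < i <= y).
  apply: subset_leq_card; apply/subsetP=> k; rewrite !inE permM.
  by case: tpermP => [->|->|]; lia.
rewrite -[excess s i j](card_preimset _ (@perm_inj _ (tperm x y))).
apply: subset_leq_card; apply/subsetP=> k; rewrite !inE permM.
by case: tpermP => [->|->|]; lia.
Qed.

Lemma bruhat_excess n (p s : 'S_n) i j :
  bruhat_le p s -> excess p i j <= excess s i j.
Proof.
move=> /connectP[c]; elim: c s => [|x c IH] s /=; first by move=> _ ->.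
by move=> /andP[/reduction_excess sx /IH xc] /xc /leq_trans; apply.
Qed.

(** * Block swaps and their parameters *)

(* One-line notation with positions and values counted from 0; the positions
   a + (c - b) <= k < c carry the values a, ..., b - 1. *)
Definition block_swap a b c k :=
  if a <= k < a + (c - b) then k + (b - a)
  else if a + (c - b) <= k < c then k - (c - b) else k.

Definition is_block_swap n (w : 'S_n) a b c :=
  (a < b < c) && (c <= n) /\ forall k : 'I_n, w k = block_swap a b c k :> nat.

Definition block_le a b c a' b' c' :=
  [&& a' <= a, c <= c', b - a <= b' - a' & c - b <= c' - b'].

Ltac block := rewrite /block_swap; do ?[case: ifP => ?]; lia.

Lemma bruhat_block_le n (p s : 'S_n) a b c a' b' c' :
  is_block_swap p a b c -> is_block_swap s a' b' c' ->
  bruhat_le p s -> block_le a b c a' b' c'.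
Proof.
move=> [abc pE] [abc' sE] ps.
(* The test point ([i], [b]) is where the two blocks of [p] meet: [i] starts its second block of
   positions, [b] is the least value of its first block. *)
have [i iE] : {i | i = a + (c - b)} by exists (a + (c - b)).
have i_n : i <= n by lia.
have b_n : b <= n by lia.
have /= ex := bruhat_excess i b ps.
have ecs := excess_compl s i_n b_n.
have ep : c - b <= excess p i b.
  have <- : #|[set k : 'I_n | a <= k < i]| = c - b.
    by rewrite card_ord_interval //; lia.
  apply: subset_leq_card; apply/subsetP=> k; rewrite !inE pE; block.
have {ep ex} ep : c - b <= excess s i b by lia.
set es := #|_| in ecs; have {ecs} es_ge : b - a <= es by lia.
have [k1] : exists k1 : 'I_n, (k1 < i) && (b <= s k1).
  have /card_gt0P[k1] : 0 < excess s i b by lia.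
  by rewrite inE; exists k1.
have [k2] : exists k2 : 'I_n, (i <= k2) && (s k2 < b).
  have /card_gt0P[k2] : 0 < es by lia.
  by rewrite inE; exists k2.
rewrite !sE => h2 h1.
(* Both blocks of [s] straddle the point (i, b), so the entries counted by
   [excess s i b] lie in the first block, those counted by [es] in the second. *)
have k1P : a' <= k1 < a' + (c' - b').
  by move: h1 h2; block.
have k2P : a' + (c' - b') <= k2 < c'.
  by move: h1 h2; block.
have c'n : c' <= n by lia.
have q'n : a' + (c' - b') <= n by lia.
(* The next four bounds yield in turn [c - b <= c' - b'], [a' <= a], [c <= c'] and
   [b - a <= b' - a']. *)
have h3 : excess s i b <= a' + (c' - b') - a'.
  rewrite -(card_ord_interval _ q'n).
  apply: subset_leq_card; apply/subsetP=> k; rewrite !inE sE.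
  by move: h1 h2 k1P k2P; block.
have h4 : excess s i b <= i - a'.
  rewrite -(card_ord_interval _ i_n).
  apply: subset_leq_card; apply/subsetP=> k; rewrite !inE sE.
  by move: h1 h2 k1P k2P; block.
have h5 : excess s i b <= c' - b.
  rewrite -(card_perm_interval s _ c'n).
  apply: subset_leq_card; apply/subsetP=> k; rewrite !inE sE.
  by move: h1 h2 k1P k2P; block.
have h6 : es <= c' - (a' + (c' - b')).
  rewrite -(card_ord_interval _ c'n).
  apply: subset_leq_card; apply/subsetP=> k; rewrite !inE sE.
  by move: h1 h2 k1P k2P; block.
by rewrite /block_le; lia.
Qed.

(** Inversion exchanges the block lengths [b - a] and [c - b], which moves the middle bound to
    [a + (c - b)]. *)
Lemma block_swapK a b c k : a < b < c ->
  block_swap a (a + (c - b)) c (block_swap a b c k) = k.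
Proof. by move=> abc; rewrite {2}/block_swap; do ?[case: ifP => ?]; block. Qed.

Lemma block_swap_ex n a b c : (a < b < c) && (c <= n) ->
  exists w : 'S_n, is_block_swap w a b c.
Proof.
move=> abc.
have lt_n (k : 'I_n) : block_swap a b c k < n by have := ltn_ord k; block.
have inj : injective (fun k : 'I_n => Ordinal (lt_n k)).
  move=> k l [/(congr1 (block_swap a (a + (c - b)) c))].
  by rewrite !block_swapK; [apply: val_inj|lia|lia].
by exists (perm inj); split=> // k; rewrite permE.
Qed.

Lemma is_block_swap_eq n (v w : 'S_n) a b c :
  is_block_swap v a b c -> is_block_swap w a b c -> v = w.
Proof.
by move=> [_ vE] [_ wE]; apply/permP=> k; apply: val_inj; rewrite /= vE wE.
Qed.

(** Reflexivity of Bruhat order gives [block_le] in both directions, and [block_le] is antisymmetric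
    on such triples. *)
Lemma is_block_swap_inj n (w : 'S_n) a b c a' b' c' :
  is_block_swap w a b c -> is_block_swap w a' b' c' ->
  [/\ a = a', b = b' & c = c'].
Proof.
move=> wE wE'.
have ww : bruhat_le w w by exact: connect0.
have := bruhat_block_le wE wE' ww; have := bruhat_block_le wE' wE ww.
by case: wE wE' => [abc _] [abc' _]; rewrite /block_le=> *; split; lia.
Qed.

Lemma is_block_swapV n (w : 'S_n) a b c :
  is_block_swap w a b c -> is_block_swap w^-1 a (a + (c - b)) c.
Proof.
move=> [abc wE]; split=> [|k]; first by lia.
by rewrite -{2}(permKV w k) wE block_swapK //; lia.
Qed.

Lemma block_swap_descents n (w : 'S_n) a b c :
  is_block_swap w a b c -> #|descents w| == 1.
Proof.
move=> [abc wE]; apply/cards1P.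
(* The only descent is at the last position of the first block. *)
have d_n : (a + (c - b)).-1 < n by lia.
exists (Ordinal d_n); apply/setP=> k; rewrite !inE -val_eqE /=.
apply/existsP/eqP=> [[j]|kE].
  by rewrite !wE; block.
have k1_n : k.+1 < n by lia.
by exists (Ordinal k1_n); rewrite eqxx !wE /=; block.
Qed.

Lemma block_swap_bigrassmannian n (w : 'S_n) a b c :
  is_block_swap w a b c -> bigrassmannian w.
Proof.
move=> wE; apply/andP; split; first exact: block_swap_descents wE.
exact: block_swap_descents (is_block_swapV wE).
Qed.

Lemma length_vector_block_swap n (w : 'S_n) l1 l2 l3 l4 :
  length_vector w l1 l2 l3 l4 -> exists a b c,
    is_block_swap w a b c /\
    [/\ l1 = a + 1, l2 = b - a, l3 = c - b & l4 = n + 1 - c].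
Proof.
move=> [a [b [c [abc cn wE lE]]]]; exists a, b, c; split=> //.
split=> [|k]; first by rewrite abc cn.
have := congr1 (fun s => nth 0 s k) wE.
rewrite (nth_map k) ?size_enum_ord ?ltn_ord // nth_ord_enum.
have k_n := ltn_ord k.
rewrite !nth_cat !size_iota /block_swap.
by case: ifP => ?; [|case: ifP => ?; [|case: ifP => ?]];
  rewrite nth_iota; do ?[case: ifP => ?]; lia.
Qed.

(** * Every bigrassmannian permutation is a block swap *)

Lemma increasing_ge (f : nat -> nat) x x' y :
  (forall k l, x <= k -> k < l -> l < x' -> f k < f l) ->
  (forall k, x <= k < x' -> y <= f k) ->
  forall i, x + i < x' -> y + i <= f (x + i).
Proof.
move=> finc fge; elim=> [|i IH] ix; first by rewrite addn0 fge; lia.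
have := finc (x + i) (x + i.+1); have := IH; lia.
Qed.

(** Mutually inverse increasing maps between integer intervals are shifts: each satisfies the lower
    bound of [increasing_ge], and a strict inequality for one would contradict the bound for the
    other. *)
Lemma increasing_blocks (f g : nat -> nat) x x' y y' :
  (forall k l, x <= k -> k < l -> l < x' -> f k < f l) ->
  (forall k l, y <= k -> k < l -> l < y' -> g k < g l) ->
  (forall k, x <= k < x' -> y <= f k < y') ->
  (forall k, y <= k < y' -> x <= g k < x') ->
  (forall k, x <= k < x' -> g (f k) = k) ->
  (forall k, y <= k < y' -> f (g k) = k) ->
  x' - x = y' - y /\ forall i, x + i < x' -> f (x + i) = y + i.
Proof.
move=> finc ginc fP gP gf fg.
have fge := @increasing_ge f x x' y finc (fun k h => proj1 (andP (fP k h))).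
have gge := @increasing_ge g y y' x ginc (fun k h => proj1 (andP (gP k h))).
have fE i : x + i < x' -> f (x + i) = y + i.
  move=> ix; have fi := fge _ ix.
  have /andP[fi1 fi2] : y <= f (x + i) < y' by apply: fP; lia.
  have gi : x + i <= g (y + i) by apply: gge; lia.
  have gi' : x <= g (y + i) < x' by apply: gP; lia.
  have := fg (y + i); have := finc (x + i) (g (y + i)).
  by move: gi; rewrite leq_eqVlt => /orP[/eqP<-|]; lia.
split=> //.
case: (ltngtP (x' - x) (y' - y)) => // h.
- have := gge (x' - x); have := gP (y + (x' - x)); lia.
- have := fge (y' - y); have := fP (x + (y' - y)); lia.
Qed.

(** Here [q] cuts the positions and [b] the values into two runs on which [f], respectively [g],
    increases. The two cuts split the graph of [f] into four pieces, each of them a shift by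
    [increasing_blocks]: two are fixed pointwise and the middle two form the swapped blocks. *)
Lemma two_increasing_blocks n (f g : nat -> nat) q b :
  (forall k, k < n -> f k < n /\ g (f k) = k) ->
  (forall k, k < n -> g k < n /\ f (g k) = k) ->
  (forall k l, k < l -> l < q -> f k < f l) ->
  (forall k l, q <= k -> k < l -> l < n -> f k < f l) ->
  (forall k l, k < l -> l < b -> g k < g l) ->
  (forall k l, b <= k -> k < l -> l < n -> g k < g l) ->
  0 < q < n -> f q < f q.-1 -> 0 < b < n ->
  exists a c, (a < b < c) && (c <= n) /\
    forall k, k < n -> f k = block_swap a b c k.
Proof.
move=> fP gP f1 f2 g1 g2 qn fq bn.
(* Only pairs lying in opposite off-diagonal blocks are inverted by [f]. *)
have R k l : k < n -> l < n ->
    (k < q <-> l < q) \/ (f k < b <-> f l < b) -> (f k < f l <-> k < l).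
  move=> kn ln; have [fk gfk] := fP _ kn; have [fl gfl] := fP _ ln.
  move: (f1 k l) (f1 l k) (f2 k l) (f2 l k) (g1 (f k) (f l)) (g1 (f l) (f k)).
  move: (g2 (f k) (f l)) (g2 (f l) (f k)); rewrite gfk gfl.
  have : f k = f l -> k = l by move=> e; rewrite -gfk -gfl e.
  have : k = l -> f k = f l by move=> ->.
  lia.
have [fp1 fp2 fq2] : [/\ f (g b) = b, f (g b.-1) = b.-1 & f q.-1 < n].
  split; [apply: (proj2 (gP _ _))..|apply: (proj1 (fP _ _))]; lia.
have [p1n p2n fqn] : [/\ g b < n, g b.-1 < n & f q < n].
  split; [apply: (proj1 (gP _ _))..|apply: (proj1 (fP _ _))]; lia.
have [q1n qn'] : q.-1 < n /\ q < n by lia.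
(* Each position is compared through [R] with four landmarks: [q], [q.-1], and the positions [g b],
   [g b.-1] of the values [b], [b.-1]. *)
have Rq k : k < n -> _ := fun kn => conj (conj (R k q kn qn') (R q k qn' kn))
   (conj (R k q.-1 kn q1n) (R q.-1 k q1n kn)).
have Rb k : k < n -> _ := fun kn => conj (conj (R k (g b) kn p1n) (R (g b) k p1n kn))
   (conj (R k (g b.-1) kn p2n) (R (g b.-1) k p2n kn)).
have h1 : f q < b <= f q.-1.
  by have := Rq q qn'; lia.
have h2 : g b < q <= g b.-1.
  have := Rb q qn'; have := Rb q.-1 q1n; rewrite fp1 fp2; lia.
have inj k : k < n -> [/\ f k = b -> k = g b, f k = b.-1 -> k = g b.-1,
    f k = f q -> k = q & f k = f q.-1 -> k = q.-1].
  move=> kn; have [_ gfk] := fP _ kn.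
  split=> e; rewrite -gfk e //; apply: (proj2 (fP _ _)); lia.
(* The landmarks bound four intervals of positions, which [f] sends into four intervals of values;
   [gB] is the same for the inverse. *)
have fB k : k < n -> [/\ f k < n, k < g b -> f k < f q,
    g b <= k < q -> b <= f k <= f q.-1,
    q <= k <= g b.-1 -> f q <= f k < b & g b.-1 < k -> f q.-1 < f k].
  move=> kn; have [fkn _] := fP _ kn; have [i1 i2 i3 i4] := inj k kn.
  have := Rq k kn; have := Rb k kn; rewrite fp1 fp2; split; lia.
have gB v : v < n -> [/\ g v < n, v < f q -> g v < g b,
    f q <= v < b -> q <= g v <= g b.-1,
    b <= v <= f q.-1 -> g b <= g v < q & f q.-1 < v -> g b.-1 < g v].
  move=> vn; have [gvn fgv] := gP _ vn; have [B1 B2 B3 B4 B5] := fB _ gvn.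
  rewrite fgv in B1 B2 B3 B4 B5; split; lia.
have fg k : k < n -> g (f k) = k by move=> /fP[].
have gf k : k < n -> f (g k) = k by move=> /gP[].
have [eA fA] : g b - 0 = f q - 0 /\ forall i, 0 + i < g b -> f (0 + i) = 0 + i.
  apply: (@increasing_blocks f g) => k *; rewrite ?fg ?gf //; try lia;
    try (apply: f1; lia); try (apply: g1; lia);
    have kn : k < n by lia.
    by have [] := fB k kn; lia.
  by have [] := gB k kn; lia.
have [eB fB'] : q - g b = (f q.-1).+1 - b /\
    forall i, g b + i < q -> f (g b + i) = b + i.
  apply: (@increasing_blocks f g) => k *; rewrite ?fg ?gf //; try lia;
    try (apply: f1; lia); try (apply: g2; lia);
    have kn : k < n by lia.
    by have [] := fB k kn; lia.
  by have [] := gB k kn; lia.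
have [eC fC] : (g b.-1).+1 - q = b - f q /\
    forall i, q + i < (g b.-1).+1 -> f (q + i) = f q + i.
  apply: (@increasing_blocks f g) => k *; rewrite ?fg ?gf //; try lia;
    try (apply: f2; lia); try (apply: g1; lia);
    have kn : k < n by lia.
    by have [] := fB k kn; lia.
  by have [] := gB k kn; lia.
have [eD fD] : n - (g b.-1).+1 = n - (f q.-1).+1 /\
    forall i, (g b.-1).+1 + i < n -> f ((g b.-1).+1 + i) = (f q.-1).+1 + i.
  apply: (@increasing_blocks f g) => k *; rewrite ?fg ?gf //; try lia;
    try (apply: f2; lia); try (apply: g2; lia);
    have kn : k < n by lia.
    by have [] := fB k kn; lia.
  by have [] := gB k kn; lia.
clear fP gP f1 f2 g1 g2 R Rq Rb inj fB gB fg gf.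
(* The value right after the descent is the least one moved, the value right before it the
   greatest. *)
exists (f q), (f q.-1).+1; split=> [|k kn]; first by lia.
have [kA|kA] := ltnP k (g b); first by have := fA k kA; rewrite add0n; block.
have [kB|kB] := ltnP k q; first by have := fB' (k - g b); rewrite subnKC //; block.
have [kC|kC] := ltnP k (g b.-1).+1.
  by have := fC (k - q); rewrite subnKC //; block.
by have := fD (k - (g b.-1).+1); rewrite subnKC //; block.
Qed.

(* [w] as a function on [nat], extended by the identity outside [0, n). *)
Definition nat_perm n (w : 'S_n) k := if insub k is Some i then w i : nat else k.

Lemma nat_perm_ord n (w : 'S_n) (i : 'I_n) : nat_perm w i = w i.
Proof. by rewrite /nat_perm valK. Qed.

Lemma nat_permK n (w : 'S_n) k :
  k < n -> nat_perm w k < n /\ nat_perm w^-1 (nat_perm w k) = k.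
Proof.
move=> kn; have -> : nat_perm w k = w (Ordinal kn) by exact: (nat_perm_ord w (Ordinal kn)).
by rewrite nat_perm_ord permK.
Qed.

Lemma increasing_step (f : nat -> nat) x y :
  (forall k, x <= k -> k.+1 < y -> f k < f k.+1) ->
  forall k l, x <= k -> k < l -> l < y -> f k < f l.
Proof.
move=> f_step k l xk; elim: l => // l IH; rewrite ltnS leq_eqVlt => /orP[/eqP<-|kl] ly.
  exact: f_step.
by have := IH kl; have := f_step l; lia.
Qed.

Lemma one_descent_blocks n (w : 'S_n) : #|descents w| == 1 -> exists q,
  [/\ 0 < q < n, nat_perm w q < nat_perm w q.-1,
      forall k l, k < l -> l < q -> nat_perm w k < nat_perm w l &
      forall k l, q <= k -> k < l -> l < n -> nat_perm w k < nat_perm w l].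
Proof.
move=> /cards1P[d dE].
have : d \in descents w by rewrite dE set11.
rewrite inE => /existsP[d' /andP[/eqP d'E lt_d]].
have step k : k.+1 < n -> k != d -> nat_perm w k < nat_perm w k.+1.
  move=> k1n kd; have kn : k < n by lia.
  have : Ordinal kn \notin descents w by rewrite dE inE -val_eqE.
  rewrite inE; apply: contraNltn => le_k.
  apply/existsP; exists (Ordinal k1n); rewrite eqxx /= -!nat_perm_ord /=.
  rewrite ltn_neqAle le_k andbT; apply/eqP=> e.
  have := proj2 (nat_permK w kn); rewrite -e (proj2 (nat_permK w k1n)); lia.
(* [descents] records the left position of a descent, whereas [q] is the start of the second run. *)
exists d.+1; have d'n := ltn_ord d'; split; first by lia.
- by rewrite /= -d'E !nat_perm_ord.
- move=> k l; apply: (increasing_step (x := 0)) => // i _ id; apply: step; lia.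
- by apply: increasing_step => i di i_n; apply: step; lia.
Qed.

Lemma bigrassmannianP n (w : 'S_n) :
  reflect (exists a b c, is_block_swap w a b c) (bigrassmannian w).
Proof.
apply: (iffP idP) => [/andP[]|[a [b [c]]]]; last exact: block_swap_bigrassmannian.
(* The descent of [w] gives the cut [q] of the positions, that of its inverse the cut [b] of the
   values. *)
move=> /one_descent_blocks[q [qn wq w1 w2]] /one_descent_blocks[b [bn _ v1 v2]].
have vK k : k < n -> nat_perm w^-1 k < n /\ nat_perm w (nat_perm w^-1 k) = k.
  by move=> /(nat_permK w^-1); rewrite invgK.
have [a [c [abc wE]]] :=
  two_increasing_blocks (@nat_permK n w) vK w1 w2 v1 v2 qn wq bn.
by exists a, b, c; split=> // k; rewrite -wE // nat_perm_ord.
Qed.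

(** * Bruhat order and covers among block swaps *)

(* [F t] is the word after [t] swaps, the next one being at [i t] and [j t]. *)
Lemma bruhat_le_swaps n (F : nat -> nat -> nat) (i j : nat -> nat) m :
  (forall t, t < m -> [/\ i t < j t < n, F t (j t) < F t (i t),
     F t.+1 (i t) = F t (j t), F t.+1 (j t) = F t (i t) &
     forall k, k < n -> k <> i t -> k <> j t -> F t.+1 k = F t k]) ->
  forall p s : 'S_n, (forall k : 'I_n, s k = F 0 k :> nat) ->
  (forall k : 'I_n, p k = F m k :> nat) -> bruhat_le p s.
Proof.
move=> step p s sE; elim: m step p => [|m IH] step p pE.
  have -> : p = s by apply/permP=> k; apply: val_inj; rewrite /= pE sE.
  exact: connect0.
have [ij lt_F Fi Fj Fk] := step m (ltnSn m).
have i_n : i m < n by lia.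
have j_n : j m < n by lia.
set x := Ordinal i_n; set y := Ordinal j_n.
pose q : 'S_n := (tperm x y * p)%g.
have qE k : q k = F m k :> nat.
  rewrite permM; case: tpermP => [->|->|kx ky]; rewrite pE //=.
  by apply: Fk; [exact: ltn_ord|move=> e; apply: kx; exact: val_inj|
    move=> e; apply: ky; exact: val_inj].
have qs : bruhat_le q s by apply: IH qE => t tm; apply: step; lia.
apply: connect_trans qs _; apply: connect1.
apply/existsP; exists x; apply/existsP; exists y.
rewrite (_ : x < y) ?qE ?lt_F /=; last by rewrite /=; lia.
by rewrite mulgA tperm2 mul1g.
Qed.

(** The entry [a] of [s] moves left past the whole first block. Position [a + (c - b)] serves as a
    buffer: after [t > 0] swaps it holds [b + t.-1], the next entry to be put back one place further
    right. *)
Lemma bruhat_le_incr_a n (p s : 'S_n) a b c :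
  is_block_swap p a.+1 b c -> is_block_swap s a b c -> bruhat_le p s.
Proof.
move=> [abc pE] [abc' sE].
pose F t k := if k == a + (c - b) then if t == 0 then a else b + t.-1
  else if a <= k < a + t then if k == a then a else b + (k - a).-1
  else block_swap a b c k.
apply: (@bruhat_le_swaps n F (fun t => a + t) (fun=> a + (c - b)) (c - b)) => [t tm|k|k].
- split; [lia|rewrite /F; block..|move=> k kn ki kj; rewrite /F; block].
- by rewrite sE /F; block.
- by rewrite pE /F; block.
Qed.

(** The entry at position [a] descends from [b] to [a] one unit at a time, and each entry of the
    second block gains one, starting from the right. *)
Lemma bruhat_le_incr_ab n (p s : 'S_n) a b c :
  is_block_swap p a.+1 b.+1 c -> is_block_swap s a b c -> bruhat_le p s.
Proof.
move=> [abc pE] [abc' sE].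
pose F t k := if k == a then b - t
  else if c - t <= k < c then k.+1 - (c - b)
  else block_swap a b c k.
apply: (@bruhat_le_swaps n F (fun=> a) (fun t => c - t.+1) (b - a)) => [t tm|k|k].
- split; [lia|rewrite /F; block..|move=> k kn ki kj; rewrite /F; block].
- by rewrite sE /F; block.
- by rewrite pE /F; block.
Qed.

(** Mirror image of [bruhat_le_incr_a]: the entry [c] moves right past the second block, with
    position [a + (c - b)] as the buffer. *)
Lemma bruhat_le_decr_c n (p s : 'S_n) a b c :
  is_block_swap p a b c -> is_block_swap s a b c.+1 -> bruhat_le p s.
Proof.
move=> [abc pE] [abc' sE].
pose F t k := if k == a + (c - b) then if t == 0 then c else b - t
  else if c - t < k <= c then if k == c then c else k - (c - b)
  else block_swap a b c.+1 k.
apply: (@bruhat_le_swaps n F (fun=> a + (c - b)) (fun t => c - t) (b - a)) => [t tm|k|k].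
- split; [lia|rewrite /F; block..|move=> k kn ki kj; rewrite /F; block].
- by rewrite sE /F; block.
- by rewrite pE /F; block.
Qed.

(** Mirror image of [bruhat_le_incr_ab]: the entry at position [c] climbs from [b] to [c], and each
    entry of the first block loses one. *)
Lemma bruhat_le_decr_bc n (p s : 'S_n) a b c :
  is_block_swap p a b c -> is_block_swap s a b.+1 c.+1 -> bruhat_le p s.
Proof.
move=> [abc pE] [abc' sE].
pose F t k := if k == c then b + t else if a <= k < a + t then b + (k - a)
  else block_swap a b.+1 c.+1 k.
apply: (@bruhat_le_swaps n F (fun t => a + t) (fun=> c) (c - b)) => [t tm|k|k].
- split; [lia|rewrite /F; block..|move=> k kn ki kj; rewrite /F; block].
- by rewrite sE /F; block.
- by rewrite pE /F; block.
Qed.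

(** For sufficiency, [s] is lowered by unit moves. As long as an outer bound differs,
    [c - a < c' - a'], so at least one block of [s] is longer than that of [p] and can be
    shortened. *)
Lemma bruhat_leE n (p s : 'S_n) a b c a' b' c' :
  is_block_swap p a b c -> is_block_swap s a' b' c' ->
  bruhat_le p s = block_le a b c a' b' c'.
Proof.
move=> pE sE; apply/idP/idP; first exact: bruhat_block_le pE sE.
have [r] := ubnP (c' - a'); elim: r a' b' c' s sE => // r IH a' b' c' s sE r_gt le.
have [[abc _] [abc' _]] := (pE, sE).
have trans u v w x : is_block_swap w u v x -> block_le a b c u v x -> x - u < r ->
    bruhat_le w s -> bruhat_le p s.
  by move=> wE le' ? ws; apply: connect_trans ws _; exact: IH wE _ le'.
have ex u v x : (u < v < x) && (x <= n) -> exists w : 'S_n, is_block_swap w u v x.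
  exact: block_swap_ex.
rewrite /block_le in le trans.
have [aa|aa] := ltnP a' a.
  have [bb|bb] := ltnP (b - a) (b' - a').
    have [|w wE] := ex a'.+1 b' c'; first by lia.
    by apply: (trans _ _ _ _ wE); [lia..|exact: bruhat_le_incr_a wE sE].
  have [|w wE] := ex a'.+1 b'.+1 c'; first by lia.
  by apply: (trans _ _ _ _ wE); [lia..|exact: bruhat_le_incr_ab wE sE].
have [cc|cc] := ltnP c c'; last first.
  have [? ? ?] : [/\ a = a', b = b' & c = c'] by split; lia.
  by subst; rewrite (is_block_swap_eq pE sE); exact: connect0.
have c'E : c' = c'.-1.+1 by lia.
rewrite c'E in sE.
have [bb|bb] := ltnP (b - a) (b' - a').
  have b'E : b' = b'.-1.+1 by lia.
  rewrite b'E in sE.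
  have [|w wE] := ex a' b'.-1 c'.-1; first by lia.
  by apply: (trans _ _ _ _ wE); [lia..|exact: bruhat_le_decr_bc wE sE].
have [|w wE] := ex a' b' c'.-1; first by lia.
by apply: (trans _ _ _ _ wE); [lia..|exact: bruhat_le_decr_c wE sE].
Qed.

(** The sum [c - a] of the block lengths is a strict rank: [block_le] with equal sums forces equal
    triples. *)
Lemma bruhat_ltE n (p s : 'S_n) a b c a' b' c' :
  is_block_swap p a b c -> is_block_swap s a' b' c' ->
  bruhat_lt p s = block_le a b c a' b' c' && (c - a < c' - a').
Proof.
move=> pE sE; rewrite /bruhat_lt (bruhat_leE pE sE) andbC.
have [le|//] := boolP (block_le _ _ _ _ _ _).
have [[abc _] [abc' _]] := (pE, sE).
rewrite !andTb; apply/idP/idP=> [/eqP ps|lt_ca].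
  move: le; rewrite /block_le => le.
  have [//|ge_ca] := ltnP; case: ps.
  have [? ? ?] : [/\ a = a', b = b' & c = c'] by split; lia.
  by subst; exact: is_block_swap_eq pE sE.
apply/eqP=> ps; rewrite ps in pE; have [] := is_block_swap_inj pE sE; lia.
Qed.

Lemma covered_byE n (p s : 'S_n) a b c a' b' c' :
  is_block_swap p a b c -> is_block_swap s a' b' c' ->
  covered_by p s = block_le a b c a' b' c' && (c' - a' == (c - a).+1).
Proof.
move=> pE sE; rewrite /covered_by (bruhat_ltE pE sE).
rewrite (block_swap_bigrassmannian pE) (block_swap_bigrassmannian sE) /=.
have [le|//] := boolP (block_le _ _ _ _ _ _); rewrite andTb.
have [[abc _] [abc' _]] := (pE, sE).
apply/andP/eqP=> [[lt_ca /existsPn no_q]|rkE]; last first.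
  split; first by lia.
  apply/existsPn=> q; apply/negP=> /and3P[/bigrassmannianP[u [v [x qE]]]].
  by rewrite (bruhat_ltE pE qE) (bruhat_ltE qE sE); lia.
apply/eqP; rewrite eqn_leq lt_ca andbT leqNgt; apply/negP=> gap.
(* If the ranks differ by at least two, any unit move up from [p] that stays below [s] lands
   strictly between them; the four cases below supply such a move. *)
have ex u v x : (u < v < x) && (x <= n) -> block_le u v x a' b' c' ->
    block_le a b c u v x -> x - u = (c - a).+1 -> False.
  move=> uvx le1 le2 rk; have [q qE] := block_swap_ex uvx.
  have := no_q q; rewrite (bruhat_ltE pE qE) (bruhat_ltE qE sE).
  by rewrite (block_swap_bigrassmannian qE) le1 le2 rk; lia.
rewrite /block_le in le ex.
have [aa|aa] := ltnP a' a; have [bb|bb] := ltnP (b - a) (b' - a').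
- by apply: (ex a.-1 b c); lia.
- by apply: (ex a.-1 b.-1 c); lia.
- by apply: (ex a b.+1 c.+1); lia.
- by apply: (ex a b c.+1); lia.
Qed.

(** * Counting saturated chains *)

Lemma cover_path n (p s : 'S_n) c a b d a' b' d' :
  is_block_swap p a b d -> is_block_swap s a' b' d' ->
  path (@covered_by n) p c -> last p c = s ->
  block_le a b d a' b' d' /\ d' - a' = d - a + size c.
Proof.
elim: c p a b d => [|q c IH] p a b d pE sE /=.
  move=> _ ps; rewrite ps in pE; have [-> -> ->] := is_block_swap_inj pE sE.
  by rewrite /block_le; lia.
move=> /andP[pq qc] last_s.
have [u [v [x qE]]] : exists u v x, is_block_swap q u v x.
  by apply/bigrassmannianP; case/and4P: pq.
have := IH q u v x qE sE qc last_s.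
by move: pq; rewrite (covered_byE pE qE) /block_le; lia.
Qed.

Lemma size_saturated_chain n (p s : 'S_n) c a b d a' b' d' :
  is_block_swap p a b d -> is_block_swap s a' b' d' ->
  saturated_chain p s c -> size c = (d' - a' - (d - a)).+1.
Proof.
move=> pE sE; case: c => [//|x c] /= /and4P[_ /eqP-> pc /eqP last_s].
by have := cover_path pE sE pc last_s; lia.
Qed.

(* The two terms of Pascal's rule for ['C(r.+1, x)], including [x = 0]. *)
Definition pascal_term r x (e : bool) :=
  if e then if x is x'.+1 then 'C(r, x') else 0 else 'C(r, x).

Lemma sum_pascal_term r x : \sum_e pascal_term r x e = 'C(r.+1, x).
Proof. by rewrite big_bool /=; case: x => [|x]; rewrite ?bin0 // binS addnC. Qed.

(* Induction on the first step out of [p], indexed by two booleans: whether it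
   lowers l1 rather than l4, and whether it raises l2 rather than l3. *)
Lemma exactly_saturated_chain n r (p s : 'S_n) a b c a' b' c' :
  is_block_swap p a b c -> is_block_swap s a' b' c' ->
  block_le a b c a' b' c' -> c' - a' = c - a + r ->
  exactly (saturated_chain p s) ('C(r, a - a') * 'C(r, b' - a' - (b - a))).
Proof.
move=> pE sE; elim: r p a b c pE => [|r IH] p a b c pE le rk.
  have ps : p = s.
    have := bruhat_ltE pE sE; rewrite /bruhat_lt (bruhat_leE pE sE) le rk addn0 ltnn.
    by rewrite andbF andbT => /negbFE/eqP.
  have [[abc _] [abc' _]] := (pE, sE).
  have [-> ->] : a - a' = 0 /\ b' - a' - (b - a) = 0.
    by move: le; rewrite /block_le; lia.
  subst s; rewrite bin0; exists [:: [:: p]]; split=> // t; rewrite inE; apply/eqP/idP=> [->|tc].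
    by rewrite unfold_in /= !eqxx (block_swap_bigrassmannian pE).
  have := size_saturated_chain pE sE tc; rewrite rk.
  by case: t tc => [|x [|y t]] //= => [/and3P[_ /eqP->]|_] //; lia.
have [[abc _] [abc' _]] := (pE, sE).
pose up (i : bool * bool) := match i with
  | (true, true) => (a.-1, b, c) | (true, false) => (a.-1, b.-1, c)
  | (false, true) => (a, b.+1, c.+1) | (false, false) => (a, b, c.+1) end.
(* This tests whether the move [i] keeps the triple below that of [s]. *)
pose ok (i : bool * bool) := (if i.1 then a' < a else c < c') &&
  (if i.2 then b - a < b' - a' else c - b < c' - b').
have [q qE] : exists q : bool * bool -> 'S_n, forall i, ok i ->
    is_block_swap (q i) (up i).1.1 (up i).1.2 (up i).2.
  apply: (@fin_all_exists _ _ (fun i w => ok i -> is_block_swap w _ _ _)).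
  (* For a forbidden move [p] is a dummy value, which [above] discards by testing [ok]. *)
  move=> i; have [oki|_] := boolP (ok i); last by exists p.
  have [|w wE] := @block_swap_ex n (up i).1.1 (up i).1.2 (up i).2; last by exists w.
  move: le oki; rewrite /ok /block_le; case: i => [[] []] /=; lia.
pose above i t := ok i && saturated_chain (q i) s t.
have above_cover i t : above i t -> covered_by p (q i).
  move=> /andP[oki _]; rewrite (covered_byE pE (qE i oki)).
  move: le oki; rewrite /ok /block_le; case: i => [[] []] /=; lia.
have exE : exactly (fun t => [exists i, above i t])
    (\sum_i pascal_term r (a - a') i.1 * pascal_term r (b' - a' - (b - a)) i.2).
  apply: exactly_exists => [i|i j t /andP[oki ti] /andP[okj tj]]; last first.
    (* A chain determines its first element, whose triple determines the move. *)
    have qij : q i = q j.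
      by case: t ti tj => //= x t /and4P[_ /eqP-> _ _] /and4P[_ /eqP-> _ _].
    have := qE i oki; rewrite qij => /is_block_swap_inj/(_ (qE j okj)).
    move: oki okj; rewrite /ok; case: i {ti qij} => [[] []]; case: j {tj} => [[] []] //=;
      by move=> ? ? [? ? ?]; lia.
  have [oki|noki] := boolP (ok i).
    apply: (@exactly_ext _ (saturated_chain (q i) s)); first by move=> t; rewrite /above oki.
    have := IH (q i) _ _ _ (qE i oki); case: i oki => [e d] oki H.
    suff -> : pascal_term r (a - a') (e, d).1 * pascal_term r (b' - a' - (b - a)) (e, d).2 =
        'C(r, (up (e, d)).1.1 - a') *
        'C(r, b' - a' - ((up (e, d)).1.2 - (up (e, d)).1.1)).
      by apply: H; move: le oki; rewrite /ok /block_le; case: e; case: d => /=; lia.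
    rewrite /pascal_term; move: le oki {H}; rewrite /ok /block_le.
    case: e; case: d => /= le oki; congr (_ * _); do ?[congr 'C(_, _); lia].
    + by case E : (a - a') => [|x]; [lia|congr 'C(_, _); lia].
    + by case E : (_ - (b - a)) => [|x]; [lia|congr 'C(_, _); lia].
    + by case E : (a - a') => [|x]; [lia|congr 'C(_, _); lia].
    + by case E : (_ - (b - a)) => [|x]; [lia|congr 'C(_, _); lia].
  rewrite (_ : _ * _ = 0); first by apply: exactly0 => t; rewrite /above (negbTE noki).
  (* A forbidden move makes one factor vanish: either Pascal's term has lower index 0, or the lower
     index is [r.+1]. For instance [c = c'] forces [a - a' = r.+1]. *)
  apply/eqP; rewrite muln_eq0 /pascal_term; move: le noki; rewrite /ok /block_le.
  have b1 : r < a - a' -> 'C(r, a - a') = 0 by move=> ?; rewrite bin_small.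
  have b2 : r < b' - a' - (b - a) -> 'C(r, b' - a' - (b - a)) = 0.
    by move=> ?; rewrite bin_small.
  by case: i => [[] []] /=; case Ea: (a - a') b1 => [|?]; case Eb: (_ - (b - a)) b2 => [|?]; lia.
(* The two choices are independent, so the sum over the four moves factors into two instances of
   Pascal's rule. *)
rewrite -!sum_pascal_term big_distrlr /= pair_bigA /=.
apply: exactly_ext (exactly_cons p exE) => -[|x [|y t]] //.
  transitivity false.
    by rewrite andbC; apply/negbTE/negP=> /andP[/existsP[i /andP[]]].
  apply/esym/negP=> xc; have := size_saturated_chain pE sE xc; rewrite /=; lia.
apply/andP/idP=> [[/eqP-> /existsP[i ti]]|].
  have := above_cover i _ ti; move: ti => /andP[_ /= /and4P[_ /eqP-> qt lt]] pq.
  by rewrite (block_swap_bigrassmannian pE) eqxx pq qt.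
move=> /= /and4P[_ /eqP-> /andP[py yt] ys]; split=> //; apply/existsP.
have /and4P[_ y_big _ _] := py.
have [u [v [w yE]]] := elimT (bigrassmannianP y) y_big.
have [le' _] := cover_path yE sE yt (eqP ys).
have [i [oki yi]] : exists i, ok i /\ is_block_swap y (up i).1.1 (up i).1.2 (up i).2.
  move: py le' (proj1 yE); rewrite (covered_byE pE yE) /ok /block_le => H1 H2 H3.
  (* The move is read off the triple of [y]: whether the left bound dropped, and whether the block
     length [b - a] grew. *)
  exists (u < a, b - a < v - u) => /=.
  split; first by case: ifP; case: ifP; lia.
  by case: ifP => h1; case: ifP => h2 /=; move: yE; congr (is_block_swap y _ _ _); lia.
exists i; rewrite /above oki (is_block_swap_eq (qE i oki) yi).
by rewrite /= y_big eqxx yt.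
Qed.

(** * Extremal elements and maximal chains *)

Lemma minimal_eltE n (p : 'S_n) a b c :
  is_block_swap p a b c -> minimal_elt p = (c - a == 2).
Proof.
move=> pE; have [abc _] := pE; rewrite /minimal_elt (block_swap_bigrassmannian pE) /=.
apply/existsPn/eqP => [no_q|ca q]; last first.
  apply/negP=> /andP[/bigrassmannianP[u [v [w qE]]]].
  rewrite (bruhat_ltE qE pE); have [uvw _] := qE; lia.
(* This adjacent transposition lies below [p], and 2 is the least possible rank. *)
have [q qE] : exists q : 'S_n, is_block_swap q a a.+1 a.+2.
  by apply: block_swap_ex; lia.
have := no_q q; rewrite (block_swap_bigrassmannian qE) (bruhat_ltE qE pE) /block_le.
by lia.
Qed.

Lemma maximal_eltE n (p : 'S_n) a b c :
  is_block_swap p a b c -> maximal_elt p = (a == 0) && (c == n).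
Proof.
move=> pE; have [abc _] := pE; rewrite /maximal_elt (block_swap_bigrassmannian pE) /=.
apply/existsPn/idP => [no_q|ca q]; last first.
  apply/negP=> /andP[/bigrassmannianP[u [v [w qE]]]].
  rewrite (bruhat_ltE pE qE); have [uvw _] := qE; lia.
(* Keeping [b] and pushing both outer bounds to the ends never shortens a block, so [q] lies above
   [p]. *)
have [q qE] : exists q : 'S_n, is_block_swap q 0 b n.
  by apply: block_swap_ex; lia.
have := no_q q; rewrite (block_swap_bigrassmannian qE) (bruhat_ltE pE qE) /block_le.
by lia.
Qed.

Lemma exactly_maximal_chain n : exactly (@maximal_chain n.+2) (4 ^ n).
Proof.
have [p pE] : exists p : 'I_n.+1 -> 'S_n.+2, forall i, is_block_swap (p i) i i.+1 i.+2.
  apply: (@fin_all_exists _ _ (fun i w => is_block_swap w _ _ _)) => i.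
  by apply: block_swap_ex; have := ltn_ord i; lia.
have [s sE] : exists s : 'I_n.+1 -> 'S_n.+2, forall j, is_block_swap (s j) 0 j.+1 n.+2.
  apply: (@fin_all_exists _ _ (fun j w => is_block_swap w _ _ _)) => j.
  by apply: block_swap_ex; have := ltn_ord j; lia.
have sum_bin : \sum_(i < n.+1) 'C(n, i) = 2 ^ n.
  by rewrite -[2]/(1 + 1) expnDn; apply: eq_bigr => i _; rewrite !exp1n !muln1.
(* Each [p i] has rank 2 and each [s j] rank [n.+2], so [n] steps separate them; the differences in
   the formula are then [i] for the left bound and [j] for the block length. *)
have -> : 4 ^ n = \sum_(ij : 'I_n.+1 * 'I_n.+1) 'C(n, ij.1) * 'C(n, ij.2).
  rewrite -(pair_bigA _ (fun i j : 'I_n.+1 => 'C(n, i) * 'C(n, j))) /=.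
  by rewrite -big_distrlr /= sum_bin -expnMn.
apply: (@exactly_ext _ (fun c => [exists ij, saturated_chain (p ij.1) (s ij.2) c])).
  move=> c; apply/existsP/existsP=> [[[i j] ijc]|[x /existsP[y /and3P[]]]].
    exists (p i); apply/existsP; exists (s j).
    by rewrite ijc (minimal_eltE (pE i)) (maximal_eltE (sE j)) andbT !eqxx andbT; lia.
  move=> xmin ymax xyc.
  have [u [v [w xE]]] : exists u v w, is_block_swap x u v w.
    by apply/bigrassmannianP; case/andP: xmin.
  have [u' [v' [w' yE]]] : exists u v w, is_block_swap y u v w.
    by apply/bigrassmannianP; case/andP: ymax.
  move: xmin ymax; rewrite (minimal_eltE xE) (maximal_eltE yE) => H1 H2.
  have [[uvw _] [uvw' _]] := (xE, yE).
  have iP : u < n.+1 by lia.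
  have jP : v'.-1 < n.+1 by lia.
  exists (Ordinal iP, Ordinal jP) => /=.
  have -> : p (Ordinal iP) = x.
    apply: (is_block_swap_eq (pE _)); move: xE => /=.
    by congr (is_block_swap x _ _ _); lia.
  have -> // : s (Ordinal jP) = y.
  apply: (is_block_swap_eq (sE _)); move: yE => /=.
  by congr (is_block_swap y _ _ _); lia.
apply: exactly_exists => [[i j]|[i j] [i' j'] c] /=.
  have := exactly_saturated_chain (r := n) (pE i) (sE j).
  rewrite (_ : j.+1 - 0 - (i.+1 - i) = j) ?subn0; last by lia.
  by apply; rewrite /block_le; have := ltn_ord i; have := ltn_ord j; lia.
case: c => //= x c /and4P[_ /eqP-> _ /eqP lj] /and4P[_ /eqP e _].
rewrite lj => /eqP e'; have := pE i'; rewrite -e => /(is_block_swap_inj (pE i))[ii _ _].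
have := sE j'; rewrite -e' => /(is_block_swap_inj (sE j))[_ [jj] _].
by congr pair; apply: val_inj.
Qed.

Theorem theorem3p4 (n : nat) (hn : 2 <= n) :
  (forall (p s : 'S_n) (l1 l2 l3 l4 m1 m2 m3 m4 : nat),
     bigrassmannian p -> bigrassmannian s ->
     length_vector p l1 l2 l3 l4 ->
     length_vector s m1 m2 m3 m4 ->
     bruhat_le p s ->
     let r := l1 - m1 + (l4 - m4) in
     [/\ (* the natural-number subtractions below are not truncated *)
         [/\ m1 <= l1, m4 <= l4 & l2 <= m2],
         forall c : seq 'S_n, saturated_chain p s c -> size c = r.+1
       & exactly (saturated_chain p s) ('C(r, l1 - m1) * 'C(r, m2 - l2))])
  /\ exactly (@maximal_chain n) (4 ^ (n - 2)).
Proof.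
split; last by case: n hn => [|[|n]] // _; rewrite !subSS subn0; exact: exactly_maximal_chain.
move=> p s l1 l2 l3 l4 m1 m2 m3 m4 _ _.
move=> /length_vector_block_swap[a [b [c [pE [-> -> _ ->]]]]].
move=> /length_vector_block_swap[a' [b' [c' [sE [-> -> _ ->]]]]].
rewrite (bruhat_leE pE sE) => le r.
have [[abc _] [abc' _]] := (pE, sE).
(* The four lengths have a fixed sum, so what the outer two lose is the gain in rank. *)
have rE : r = c' - a' - (c - a) by move: le; rewrite /r /block_le; lia.
split; first by move: le; rewrite /block_le => ?; split; lia.
  by move=> ch; rewrite rE; exact: (size_saturated_chain pE sE).
rewrite subnDr; apply: (exactly_saturated_chain pE sE) => //.
by move: le; rewrite /block_le; lia.
Qed.
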